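(* Let $\epsilon \in (0,1)$ and $\gamma \in (0,1)$, and let $\ell$ be a positive integer with $$\ell \ge \max\left\{ \frac{2e^2}{\gamma}\log\frac{1}{\epsilon},\ \frac{2e^2}{\gamma}\log(4e^2)\right\}.$$ Then for all sufficiently large $n\ge \ell$ the following holds. If $T_n$ is a uniform attachment tree with seed $S_\ell=P_\ell$ (a path on $\ell$ vertices), then there exists a seed-finding algorithm that outputs a vertex set $H_n\subset\{1,\ldots,n\}$ with $|H_n|\ge (1-\gamma)\ell$ such that $$\mathbb{P}\left\{ H_n\subset P_\ell\right\}\ge 1-\epsilon .$$
   Context: Uniform attachment tree with seed: let $\ell\ge 1$ and let $S_\ell$ be a tree on the vertex set $\{1,\ldots,\ell\}$. For $n>\ell$, a random tree $T_n$ on $\{1,\ldots,n\}$ is a uniform attachment tree with seed $S_\ell$ if it is generated as follows: $T_\ell=S_\ell$; and for $\ell<i\le n$, $T_i$ is obtained from $T_{i-1}$ by joining vertex $i$ by an edge to a vertex of $T_{i-1}$ chosen uniformly at random, independently of all previous choices. Path: $P_\ell$ is a tree on the vertex set $\{1,\ldots,\ell\}$ that has exactly two vertices of degree one and $\ell-2$ vertices of degree two. The seed is identified with its vertex set, so $H_n\subset P_\ell$ means $H_n\subset\{1,\ldots,\ell\}$. Seed-finding algorithm: it observes $T_n$ with the vertex labels hidden (it may depend on $n$, $\ell$, $\epsilon$, $\gamma$ and on the knowledge that the seed is a path on $\ell$ vertices) and outputs a set $H_n$ of vertices of the observed tree. Formally: let $\sigma$ be a uniformly random permutation of $\{1,\ldots,n\}$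 independent of $T_n$; the algorithm is a (possibly randomized, with independent randomness) map $A$ from trees on $\{1,\ldots,n\}$ to subsets of $\{1,\ldots,n\}$, applied to the relabeled tree $\sigma(T_n)$, and $H_n=\sigma^{-1}(A(\sigma(T_n)))$. *)

(* Defs.v *)
From mathcomp Require Import all_boot all_order all_algebra all_fingroup.
From mathcomp Require Import all_classical all_reals all_analysis.

Set Implicit Arguments.
Unset Strict Implicit.
Unset Printing Implicit Defensive.

Import Order.TTheory GRing.Theory Num.Theory.

Local Open Scope ring_scope.

(** Vertex labels 1, ..., n are encoded as the elements 0, ..., n-1 of ['I_n]. All
    the random objects take finitely many values, so probabilities are finite
    sums of a mass function. *)

(** A graph is given by its set of edges. That edges are pairs of distinct vertices is
    part of [is_tree]. *)
Notation graph n := {set {set 'I_n}}.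

Definition adj (n : nat) (G : graph n) : rel 'I_n :=
  fun x y => [set x; y]%SET \in G.

Definition degree (n : nat) (G : graph n) (v : 'I_n) : nat :=
  #|[set e in G | v \in e]%SET|.

Definition acyclic (n : nat) (G : graph n) : Prop :=
  forall c : seq 'I_n, (2 < size c)%N -> ~ ucycle (adj G) c.

Definition is_tree (n : nat) (G : graph n) : Prop :=
  [/\ (0 < n)%N,
      (forall e : {set 'I_n}, e \in G -> #|e| = 2%N),
      (forall x y : 'I_n, connect (adj G) x y)
    & acyclic G].

Definition is_path (l : nat) (G : graph l) : Prop :=
  [/\ is_tree G,
      #|[set v | degree G v == 1%N]%SET| = 2%N
    & #|[set v | degree G v == 2%N]%SET| = (l - 2)%N].

Definition attach (n : nat) (G : graph n) (v : 'I_n) : graph n.+1 :=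
  ([set ord_max; widen_ord (leqnSn n) v]
     |: [set widen_ord (leqnSn n) @: (e : {set 'I_n}) | e in G])%SET.

(** Probability mass function of the uniform attachment tree on [m + l] vertices
    with seed [S]: conditionally on the tree on [m + l] vertices, the next
    vertex is joined to a uniformly chosen vertex of that tree. *)
Fixpoint ua_law (R : realType) (l : nat) (S : graph l) (m : nat) :
    graph (m + l) -> R :=
  match m return graph (m + l) -> R with
  | 0%N => fun t => (t == S)%:R
  | k.+1 => fun t =>
      \sum_(t' : graph (k + l)) ua_law R S t' *
        \sum_(v : 'I_(k + l)) ((k + l)%:R)^-1 * (t == attach t' v)%:R
  end.

Definition relabel (n : nat) (s : 'S_n) (G : graph n) : graph n :=
  [set s @: (e : {set 'I_n}) | e in G]%SET.

(** A randomized algorithm is given by the law [A t] of its output on each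
    observed tree [t]; its values on graphs that are not trees are irrelevant. *)
Definition is_randomized_algorithm (R : realType) (n : nat)
    (A : graph n -> {set 'I_n} -> R) : Prop :=
  forall t : graph n, is_tree t ->
    (forall H : {set 'I_n}, 0 <= A t H) /\ \sum_(H : {set 'I_n}) A t H = 1.

(** The joint law of the tree T_n, of the hidden uniform relabeling sigma, which
    is independent of T_n, and of the output of [A] on sigma(T_n). *)
Definition joint_law (R : realType) (l : nat) (S : graph l) (m : nat)
    (A : graph (m + l) -> {set 'I_(m + l)} -> R)
    (w : graph (m + l) * 'S_(m + l) * {set 'I_(m + l)}) : R :=
  let: (t, s, K) := w in
  ua_law R S t * (#|{: 'S_(m + l)}|%:R)^-1 * A (relabel s t) K.

(** H_n = sigma^-1 (A (sigma (T_n))) *)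
Definition found_set (n : nat) (w : graph n * 'S_n * {set 'I_n}) :
    {set 'I_n} :=
  let: (_, s, K) := w in ((s^-1)%g @: K)%SET.

Definition seed_vertices (l m : nat) : {set 'I_(m + l)} :=
  [set v : 'I_(m + l) | (v < l)%N]%SET.

Definition prob_found_in_seed (R : realType) (l : nat) (S : graph l) (m : nat)
    (A : graph (m + l) -> {set 'I_(m + l)} -> R) : R :=
  \sum_(w : graph (m + l) * 'S_(m + l) * {set 'I_(m + l)}
        | found_set w \subset seed_vertices l m) joint_law S A w.

(* Main.v *)
Require Import Defs.
From mathcomp Require Import all_boot all_order all_algebra all_fingroup.
From mathcomp Require Import all_classical all_reals all_analysis.
From mathcomp Require Import zify ring lra.

(* Among all pairs (x, y) separated by at least l - g vertices (endpoints included),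
   where g is about gamma * l, pick one that maximises the smaller of the numbers of
   vertices cut off by x from y and by y from x, and output the vertices separating
   x from y. The pair of seed vertices at positions g/2 from the two ends of the path
   cuts off A and B vertices, where A and B are the total sizes of the subtrees hanging
   from the first and the last g/2 + 1 seed vertices. A pair leaving the seed can
   only do as well if a non-seed vertex u has a subtree at least as large as A or B;
   since the separating path is long, u is rooted near an end of the seed or is deep.

   For a fixed p, the sum over the vertices u rooted outside the zone of A of
   w(u) 2^depth(u) ((p - 2) C(s(u) + p - 1, p) + 2) / C(A - 1, p), with s(u) the size
   of the subtree of u and w(u) depending only on its root, is a martingale. Markov's
   inequality with p = g/4 bounds the probability of a bad u by O(g) / C(2p, p). *)

Set Implicit Arguments.
Unset Strict Implicit.
Unset Printing Implicit Defensive.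

Import Order.TTheory GRing.Theory Num.Theory.

Local Open Scope ring_scope.

(** * Attachment histories: ancestors, depths, subtrees *)

Section History.

Variable l : nat.
Local Open Scope nat_scope.

(** A history lists the parents of the non-seed vertices, the latest vertex
    first, so that the head of [v :: h] is the parent of vertex [size h + l]. *)
Fixpoint valid (h : seq nat) : bool :=
  if h is v :: h' then (v < size h' + l) && valid h' else true.

Fixpoint ancestors (h : seq nat) (w : nat) : seq nat :=
  if h is v :: h' then
    if w == size h' + l then w :: ancestors h' v else ancestors h' w
  else [:: w].

Definition seed_root (h : seq nat) (w : nat) : nat := last w (ancestors h w).

(** Counting only the non-seed ancestors makes this the distance to the seed. *)
Definition depth (h : seq nat) (w : nat) : nat := count (leq l) (ancestors h w).

Definition subtree_size (h : seq nat) (u : nat) : nat :=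
  \sum_(w < size h + l) (u \in ancestors h w).

Lemma ancestors_old v h w :
  w < size h + l -> ancestors (v :: h) w = ancestors h w.
Proof. by move=> hw /=; rewrite ltn_eqF. Qed.

Lemma ancestors_new v h :
  ancestors (v :: h) (size h + l) = size h + l :: ancestors h v.
Proof. by rewrite /= eqxx. Qed.

Lemma ancestors_seed h w : w < l -> ancestors h w = [:: w].
Proof.
move=> hw; elim: h => //= v h IH.
by rewrite ltn_eqF // (leq_trans hw) // leq_addl.
Qed.

Lemma seed_root_seed h w : w < l -> seed_root h w = w.
Proof. by move=> hw; rewrite /seed_root ancestors_seed. Qed.

Lemma depth_seed h w : w < l -> depth h w = 0.
Proof. by move=> hw; rewrite /depth ancestors_seed //= leqNgt hw. Qed.

Lemma mem_ancestors h w : w \in ancestors h w.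
Proof.
elim: h w => [|v h IH] w /=; first by rewrite inE.
by case: ifP => _ //; rewrite inE eqxx.
Qed.

Lemma ancestors_neq0 h w : ancestors h w != [::].
Proof. by move: (mem_ancestors h w); case: (ancestors h w). Qed.

Lemma last_ancestors h w x : last x (ancestors h w) = seed_root h w.
Proof. by rewrite /seed_root; move: (ancestors_neq0 h w); case: (ancestors h w). Qed.

Lemma seed_root_old v h w : w < size h + l -> seed_root (v :: h) w = seed_root h w.
Proof. by move=> hw; rewrite /seed_root ancestors_old. Qed.

Lemma seed_root_new v h : seed_root (v :: h) (size h + l) = seed_root h v.
Proof. by rewrite /seed_root ancestors_new /= last_ancestors. Qed.

Lemma depth_old v h w : w < size h + l -> depth (v :: h) w = depth h w.
Proof. by move=> hw; rewrite /depth ancestors_old. Qed.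

Lemma depth_new v h : depth (v :: h) (size h + l) = (depth h v).+1.
Proof. by rewrite /depth ancestors_new /= leq_addl. Qed.

Lemma ancestors_leq h w u : valid h -> u \in ancestors h w -> u <= w.
Proof.
elim: h w => [|v h IH] w /=; first by rewrite inE => _ /eqP->.
case/andP=> hv vh; case: eqP => [->|_]; last exact: IH.
rewrite inE => /orP[/eqP-> //|/(IH _ vh) huv].
exact: leq_trans huv (ltnW hv).
Qed.

Lemma seed_root_ancestor h w u :
  valid h -> w < size h + l -> u \in ancestors h w -> seed_root h u = seed_root h w.
Proof.
elim: h w => [|v h IH] w /=; first by rewrite inE => _ _ /eqP->.
case/andP=> hv vh hw; case: eqP => [->|/eqP nw].
  rewrite inE seed_root_new => /orP[/eqP->|hu]; first exact: seed_root_new.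
  rewrite seed_root_old; first exact: IH.
  exact: leq_ltn_trans (ancestors_leq vh hu) hv.
have {}hw : w < size h + l by rewrite addSn ltnS leq_eqVlt (negPf nw) in hw.
move=> hu; rewrite !seed_root_old //; first exact: IH.
exact: leq_ltn_trans (ancestors_leq vh hu) hw.
Qed.

Lemma seed_root_lt h w : valid h -> w < size h + l -> seed_root h w < l.
Proof.
elim: h w => [|v h IH] w //=.
case/andP=> hv vh; rewrite addSn ltnS leq_eqVlt => /orP[/eqP->|hw].
  by rewrite seed_root_new; exact: IH.
by rewrite seed_root_old //; exact: IH.
Qed.

Lemma seed_ancestor h w u :
  valid h -> w < size h + l -> u \in ancestors h w -> u < l -> u = seed_root h w.
Proof. by move=> vh hw hu ul; rewrite -(seed_root_ancestor vh hw hu) seed_root_seed. Qed.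

Lemma mem_seed_root_ancestors h w : seed_root h w \in ancestors h w.
Proof.
rewrite /seed_root; move: (ancestors_neq0 h w); case: (ancestors h w) => //= a s _.
exact: mem_last.
Qed.

Lemma size_ancestors h w :
  valid h -> w < size h + l -> size (ancestors h w) = (depth h w).+1.
Proof.
elim: h w => [|v h IH] w /=; first by rewrite add0n => _ hw; rewrite depth_seed.
case/andP=> hv vh; rewrite addSn ltnS leq_eqVlt => /orP[/eqP->|hw].
  by rewrite eqxx depth_new /= IH.
by rewrite ltn_eqF // depth_old // IH.
Qed.

Lemma subtree_size_old v h u :
  u < size h + l ->
  subtree_size (v :: h) u = subtree_size h u + (u \in ancestors h v).
Proof.
move=> hu; rewrite /subtree_size /= addSn big_ord_recr /=.
rewrite eqxx inE ltn_eqF //=; congr addn.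
by apply: eq_bigr => w _; rewrite ltn_eqF.
Qed.

Lemma subtree_size_new v h :
  valid (v :: h) -> subtree_size (v :: h) (size h + l) = 1.
Proof.
move=> /= /andP[hv vh]; rewrite /subtree_size /= addSn big_ord_recr /=.
rewrite eqxx inE eqxx /= big1 // => w _; rewrite ltn_eqF //.
case E: (_ \in _) => //; move: (ancestors_leq vh E).
by rewrite leqNgt ltn_ord.
Qed.

Section Positions.

Variable pos : nat -> nat.

(** For [a = g./2] this is the A of the overview; B comes from replacing [pos] by
    [rev_pos l pos]. *)
Definition zone_size (a : nat) (h : seq nat) : nat :=
  \sum_(w < size h + l) (pos (seed_root h w) <= a).

Lemma zone_size_cons a v h :
  zone_size a (v :: h) = zone_size a h + (pos (seed_root h v) <= a).
Proof.
rewrite /zone_size /= addSn big_ord_recr /= seed_root_new; congr addn.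
by apply: eq_bigr => w _; rewrite seed_root_old.
Qed.

(** The zone contains the subtree of [u] and also the seed root of [u], which lies outside that
    subtree. *)
Lemma subtree_size_zone a h u :
  valid h -> l <= u < size h + l -> pos (seed_root h u) <= a ->
  subtree_size h u < zone_size a h.
Proof.
move=> vh /andP[lu hu] pu.
have hr := seed_root_lt vh hu.
have hr' : seed_root h u < size h + l by rewrite (leq_trans hr) // leq_addl.
rewrite /subtree_size /zone_size (bigD1 (Ordinal hr')) //=.
rewrite [X in _ < X](bigD1 (Ordinal hr')) //=.
have -> : u \in ancestors h (seed_root h u) = false.
  by rewrite ancestors_seed // inE gtn_eqF // (leq_trans hr).
rewrite (seed_root_seed _ hr) pu add0n add1n ltnS.
apply: leq_sum => w _; case E: (_ \in _) => //.
by rewrite -(seed_root_ancestor vh (ltn_ord w) E) pu.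
Qed.

Fixpoint edge (h : seq nat) (x y : nat) : bool :=
  if h is v :: h' then
    [|| (x == size h' + l) && (y == v), (y == size h' + l) && (x == v)
      | edge h' x y]
  else [&& x < l, y < l & (pos x == (pos y).+1) || (pos y == (pos x).+1)].

Lemma edge_lt h x y : valid h -> edge h x y -> (x < size h + l) && (y < size h + l).
Proof.
elim: h => [_ /= /and3P[-> ->] //|v h IH] /= /andP[hv vh].
case/or3P => [/andP[/eqP-> /eqP->]|/andP[/eqP-> /eqP->]|/(IH vh)]; lia.
Qed.

Lemma edge_seed h x y : x < l -> y < l -> edge h x y = edge [::] x y.
Proof.
move=> xl yl; elim: h => //= v h ->.
have -> : (x == size h + l) = false by lia.
by have -> : (y == size h + l) = false by lia.
Qed.

(** An attachment edge joins a vertex to its parent, so only seed edges change the root. *)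
Lemma edge_seed_root h x y :
  valid h -> edge h x y ->
  seed_root h x = seed_root h y \/ [/\ x < l, y < l & edge [::] x y].
Proof.
elim: h => [_ /= /and3P[-> -> ->]|v h IH]; first by right.
move=> /= /andP[hv vh].
case/or3P => [/andP[/eqP-> /eqP->]|/andP[/eqP-> /eqP->]|hxy].
- by left; rewrite seed_root_new seed_root_old.
- by left; rewrite seed_root_new seed_root_old.
have /andP[hx hy] := edge_lt vh hxy; rewrite !seed_root_old //; exact: IH.
Qed.

Lemma parent_edge h x : valid h -> l <= x < size h + l ->
  exists2 y, y < x & edge h x y /\ ancestors h x = x :: ancestors h y.
Proof.
elim: h => [_ /=|v h IH] /=; first by lia.
case/andP=> hv vh /andP[lx]; rewrite addSn ltnS leq_eqVlt => /orP[/eqP->|hx].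
  by exists v => //; rewrite !eqxx (ltn_eqF hv).
have [|y yx [exy E]] := IH vh; first by rewrite lx.
exists y => //; rewrite exy !orbT; split=> //.
by rewrite !ltn_eqF // (ltn_trans yx).
Qed.

End Positions.

End History.

(** * Separation of vertices in a graph *)

Definition avoid (n : nat) (G : graph n) (s : 'I_n) : rel 'I_n :=
  fun u w => [&& adj G u w, u != s & w != s].

(* The endpoints [x] and [y] are included as soon as [x != y]. *)
Definition separators (n : nat) (G : graph n) (x y : 'I_n) : {set 'I_n} :=
  [set s | ~~ connect (avoid G s) x y]%SET.

(* The number of vertices that [x] cuts off from [y], [x] itself included when [x != y]. *)
Definition beyond (n : nat) (G : graph n) (x y : 'I_n) : nat :=
  #|[set v | ~~ connect (avoid G x) v y]%SET|.

Definition score (n : nat) (G : graph n) (z : 'I_n * 'I_n) : nat :=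
  minn (beyond G z.1 z.2) (beyond G z.2 z.1).

Definition best_pair (n : nat) (k : nat) (G : graph n) (z : 'I_n * 'I_n) : bool :=
  (k <= #|separators G z.1 z.2|)%N &&
  [forall z', (k <= #|separators G z'.1 z'.2|)%N ==> (score G z' <= score G z)%N].

Lemma adj_sym n (G : graph n) : symmetric (adj G).
Proof. by move=> x y; rewrite /adj finset.setUC. Qed.

Lemma avoid_sym n (G : graph n) s : symmetric (avoid G s).
Proof. by move=> x y; rewrite /avoid adj_sym [(y != s) && _]andbC. Qed.

Lemma connect_avoid_sym n (G : graph n) s : connect_sym (avoid G s).
Proof. exact/sym_connect_sym/avoid_sym. Qed.

Lemma separators_sym n (G : graph n) x y : separators G x y = separators G y x.
Proof. by apply/setP=> s; rewrite !inE connect_avoid_sym. Qed.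

Lemma separators_refl n (G : graph n) x : separators G x x = finset.set0.
Proof. by apply/setP=> s; rewrite !inE connect0. Qed.

Lemma card_le_size n (A : {set 'I_n}) (s : seq nat) :
  (forall x, x \in A -> (x : nat) \in s) -> (#|A| <= size s)%N.
Proof.
move=> As; rewrite cardE -(size_map (@nat_of_ord n)).
apply: uniq_leq_size; first by rewrite (map_inj_uniq val_inj) enum_uniq.
by move=> i /mapP[x]; rewrite mem_enum => /As ? ->.
Qed.

(** [pos] is the position of a seed vertex along the path and [q] the vertex at a position; being
    functions on naturals, they are constrained only below [l]. *)
Definition seed_order (l : nat) (pos q : nat -> nat) : Prop :=
  (forall i, (i < l)%N -> (q i < l)%N /\ pos (q i) = i) /\
  (forall x, (x < l)%N -> (pos x < l)%N /\ q (pos x) = x).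

(** * Separators in the tree grown by a history *)

Section Separation.

Local Open Scope nat_scope.

Variables (l n : nat) (h : seq nat) (pos q : nat -> nat) (G : graph n).
Hypothesis vh : valid l h.
Hypothesis nE : n = size h + l.
Hypothesis ord_pos : seed_order l pos q.
Hypothesis adjE : forall x y : 'I_n, adj G x y = edge l pos h x y.

Local Notation anc := (ancestors l h).
Local Notation rpos x := (pos (seed_root l h x)).

Lemma root_in_seed (x : 'I_n) : seed_root l h x < l.
Proof. by apply: seed_root_lt; rewrite -?nE ?ltn_ord. Qed.

Lemma seed_lt x : x < l -> x < n.
Proof. by move=> xl; rewrite nE (leq_trans xl) // leq_addl. Qed.

(** Climb from [x] parent by parent: labels decrease on the way, so only ancestors with label at
    least [u] are met. *)
Lemma connect_ancestor (s x u : 'I_n) :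
  (u : nat) \in anc x -> (forall w, w \in anc x -> u <= w -> w != s) ->
  connect (avoid G s) x u.
Proof.
have [k] := ubnP (x : nat); elim: k x => // k IH x xk ux ns.
have [xl|lx] := ltnP x l.
  by move: ux; rewrite ancestors_seed // inE => /eqP/val_inj->; rewrite connect0.
have hx : l <= x < size h + l by rewrite lx -nE ltn_ord.
have [y yx [exy E]] := parent_edge pos vh hx.
have yn : y < n by rewrite (ltn_trans yx).
move: ux; rewrite E inE => /orP[/eqP/val_inj-> //|uy].
have uley := ancestors_leq vh uy.
apply: (@connect_trans _ _ (Ordinal yn)).
  apply: connect1; rewrite /avoid adjE exy /=; apply/andP; split.
    by apply: (ns x); rewrite ?mem_ancestors // ltnW // (leq_ltn_trans uley).
  by apply: (ns y) => //; rewrite E inE mem_ancestors orbT.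
apply: IH => //=; first by lia.
by move=> w wy; apply: ns; rewrite E inE wy orbT.
Qed.

Lemma connect_seed (s x y : 'I_n) : x < l -> y < l ->
  (forall w, w < l -> minn (pos x) (pos y) <= pos w <= maxn (pos x) (pos y) ->
     w != s) ->
  connect (avoid G s) x y.
Proof.
have [oq op] := ord_pos.
wlog xy : x y / pos x <= pos y => [W xl yl ns|].
  have [|yx] := leqP (pos x) (pos y); first by move=> ?; apply: W.
  rewrite connect_avoid_sym; apply: W => //; first exact: ltnW.
  by move=> w wl Hw; apply: ns => //; rewrite minnC maxnC.
rewrite (minn_idPl xy) (maxn_idPr xy) => xl yl.
have [k] := ubnP (pos y - pos x); elim: k x xl xy => // k IH x xl xy hk ns.
have := xy; rewrite leq_eqVlt => /orP[/eqP E|xy'].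
  have -> // : x = y.
  by apply: val_inj => /=; rewrite -(proj2 (op _ xl)) E (proj2 (op _ yl)).
have [yl' _] := op _ yl.
have [zl zE] := oq _ (leq_ltn_trans xy' yl').
apply: (@connect_trans _ _ (Ordinal (seed_lt zl))); last first.
  apply: IH => //=; rewrite ?zE //; first by lia.
  by move=> w wl Hw; apply: ns => //; lia.
apply: connect1; rewrite /avoid adjE edge_seed //= xl zl zE eqxx orbT /=.
by rewrite -!val_eqE /= !ns // ?zE; lia.
Qed.

(** Both vertices climb to their roots without meeting [u], and the walk between the roots stays in
    the seed. *)
Lemma connect_off (u v y : 'I_n) :
  l <= u -> (u : nat) \notin anc v -> (u : nat) \notin anc y ->
  connect (avoid G u) v y.
Proof.
have rn (v' : 'I_n) : seed_root l h v' < n by exact/seed_lt/root_in_seed.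
have toroot (v' : 'I_n) : (u : nat) \notin anc v' ->
    connect (avoid G u) v' (Ordinal (rn v')).
  move=> uv; apply: connect_ancestor; first exact: mem_seed_root_ancestors.
  by move=> w wv _; apply: contraNneq uv => <-.
move=> lu uv uy; apply: connect_trans (toroot _ uv) _.
rewrite connect_avoid_sym; apply: connect_trans (toroot _ uy) _.
apply: connect_seed; rewrite /= ?root_in_seed //.
by move=> w wl _; rewrite ltn_eqF // (leq_trans wl).
Qed.

(** By [connect_off], deleting [u] leaves every vertex outside its subtree connected to [y]. This
    bounds the score of pairs leaving the seed. *)
Lemma beyond_off (u y : 'I_n) :
  l <= u -> (u : nat) \notin anc y -> beyond G u y <= subtree_size l h u.
Proof.
move=> lu uy; rewrite /beyond /subtree_size.
have -> : \sum_(w < size h + l) ((u : nat) \in anc w) =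
          #|[set v : 'I_n | (u : nat) \in anc v]%SET|.
  rewrite -(big_mkord xpredT (fun w => ((u : nat) \in anc w) : nat)) -nE.
  rewrite big_mkord -sum1dep_card [RHS]big_mkcond /=.
  by apply: eq_bigr => i _; case: (_ \in _).
apply: subset_leq_card; apply/fintype.subsetP=> v; rewrite !inE.
by apply: contraNT => uv; apply: connect_off.
Qed.

(** The vertices other than [s] rooted at or before [pos s] form a closed set once [s] is deleted:
    an edge leaving it would change the root, hence be a seed edge, and consecutive positions cannot
    jump over [pos s]. *)
Lemma disconnect (s v y : 'I_n) : s < l -> rpos v <= pos s -> v != y ->
  y = s \/ pos s < rpos y -> ~~ connect (avoid G s) v y.
Proof.
have [oq op] := ord_pos.
move=> sl vs vy ys; apply/negP => cvy.
have [E|nvs] := eqVneq v s.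
  move: cvy; rewrite E => /connectP[[|z p] /=]; last by rewrite /avoid eqxx andbF.
  by move=> _ E'; move: vy; rewrite E E' eqxx.
pose C := [pred w : 'I_n | (rpos w <= pos s) && (w != s)].
have clC : fingraph.closed (avoid G s) C.
  move=> u w; rewrite /avoid adjE => /and3P[euw us ws]; rewrite !inE us ws !andbT.
  have [->//|[ul wl]] := edge_seed_root vh euw.
  rewrite !seed_root_seed // /edge ul wl /= => uw.
  have pu : pos u != pos s.
    apply: contraNneq us => E; apply/eqP/val_inj.
    by rewrite /= -(proj2 (op _ ul)) E (proj2 (op _ sl)).
  have pw : pos w != pos s.
    apply: contraNneq ws => E; apply/eqP/val_inj.
    by rewrite /= -(proj2 (op _ wl)) E (proj2 (op _ sl)).
  lia.
have := closed_connect clC cvy; rewrite !inE vs nvs /=.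
by case: ys => [->|ys]; rewrite ?eqxx ?andbF // leqNgt ys.
Qed.

(** The climb from [y] to [x] avoids every vertex off the ancestral line of [y]. *)
Lemma separators_ancestors (x y : 'I_n) :
  (x : nat) \in anc y -> #|separators G x y| <= (depth l h y).+1.
Proof.
move=> xy; rewrite -size_ancestors -?nE ?ltn_ord //; apply: card_le_size => s.
rewrite separators_sym inE; apply: contraNT => sy.
apply: connect_ancestor => // w wy _.
by apply: contraNneq sy => <-.
Qed.

(** Climbing from [x], walking along the seed and descending to [y] is a walk that every separator
    must meet. *)
Lemma separators_sub (x y s : 'I_n) : s \in separators G x y ->
  [\/ (s : nat) \in anc x, (s : nat) \in anc y |
    (s < l) && (minn (rpos x) (rpos y) <= pos s <= maxn (rpos x) (rpos y))].
Proof.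
rewrite inE => H.
case: (boolP ((s : nat) \in anc x)) => sx; first by constructor 1.
case: (boolP ((s : nat) \in anc y)) => sy; first by constructor 2.
constructor 3; apply: contraNT H => ns.
have rn (v' : 'I_n) : seed_root l h v' < n by exact/seed_lt/root_in_seed.
have toroot (v' : 'I_n) : (s : nat) \notin anc v' ->
    connect (avoid G s) v' (Ordinal (rn v')).
  move=> uv; apply: connect_ancestor; first exact: mem_seed_root_ancestors.
  by move=> w wv _; apply: contraNneq uv => <-.
apply: connect_trans (toroot _ sx) _.
rewrite connect_avoid_sym; apply: connect_trans (toroot _ sy) _.
rewrite connect_avoid_sym; apply: connect_seed; rewrite /= ?root_in_seed //.
by move=> w wl Hw; apply: contraNneq ns => <-; rewrite wl.
Qed.

Lemma separators_card (x y : 'I_n) :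
  #|separators G x y| <= depth l h x + depth l h y +
     (maxn (rpos x) (rpos y) - minn (rpos x) (rpos y)).+1.
Proof.
have [oq op] := ord_pos.
pose i := minn (rpos x) (rpos y); pose j := maxn (rpos x) (rpos y).
rewrite /depth -!size_filter -[(_ - _).+1](size_iota i) -[size (iota _ _)](size_map q).
rewrite -!size_cat; apply: card_le_size => s /separators_sub.
have [sl|ls] := ltnP s l; last first.
  rewrite !mem_cat !mem_filter ls /= => -[sx|sy|//].
  - by rewrite sx.
  - by rewrite sy !orbT.
move=> Hs; rewrite mem_cat orbC; apply/orP; left.
have Hp : i <= pos s <= j.
  rewrite /i /j; case: Hs => [sx|sy|/andP[] //].
    by rewrite (seed_ancestor vh _ sx sl) -?nE ?ltn_ord //; lia.
  by rewrite (seed_ancestor vh _ sy sl) -?nE ?ltn_ord //; lia.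
apply/mapP; exists (pos s); last by rewrite (proj2 (op _ sl)).
by rewrite mem_iota; move: Hp; rewrite /i /j; lia.
Qed.

(* The non-seed vertices that can end a separating path of [l - g] vertices: the
   further their root is from both ends of the seed, the deeper they must be. *)
Definition suspicious (g u : nat) : bool :=
  (l <= u) && (minn (rpos u) (l.-1 - rpos u) <= depth l h u + g).

(** If neither endpoint is an ancestor of the other, the gap between the roots plus both depths is
    at least l - g - 1. The seed steps outside the gap then number at most the two depths plus g, so
    one root is close enough to an end. If one is an ancestor of the other, the ancestral line
    forces the lower endpoint to depth at least l - g - 1. *)
Lemma suspicious_end (g : nat) (x y : 'I_n) :
  g.+2 <= l -> l - g <= #|separators G x y| ->
  [\/ (x < l) && (y < l),
      suspicious g x /\ (x : nat) \notin anc y |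
      suspicious g y /\ (y : nat) \notin anc x].
Proof.
have [oq op] := ord_pos.
move=> gl Hk; have [xy|nxy] := eqVneq x y.
  by move: Hk; rewrite xy separators_refl finset.cards0; lia.
have px := proj1 (op _ (root_in_seed x)); have py := proj1 (op _ (root_in_seed y)).
have d0 (z : 'I_n) : z < l -> depth l h z = 0 by exact: depth_seed.
rewrite /suspicious.
have [xay|xay] := boolP ((x : nat) \in anc y).
  have := separators_ancestors xay => Hy.
  have [yl|ly] := ltnP y l; first by move: Hy; rewrite d0 //; lia.
  constructor 3; split; first by lia.
  apply/negP => yax; case/eqP: nxy; apply/val_inj/anti_leq.
  by rewrite (ancestors_leq vh xay) (ancestors_leq vh yax).
have [yax|yax] := boolP ((y : nat) \in anc x).
  have := separators_ancestors yax; rewrite separators_sym => Hx.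
  have [xl|lx] := ltnP x l; first by move: Hx; rewrite d0 //; lia.
  by constructor 2; split; first lia.
have H := separators_card x y.
have [xl|lx] := ltnP x l; have [yl|ly] := ltnP y l.
- by constructor 1.
- by constructor 3; split=> //; move: H; rewrite d0 //; lia.
- by constructor 2; split=> //; move: H; rewrite (d0 y) //; lia.
have [Hx|Hx] := boolP (minn (rpos x) (l.-1 - rpos x) <= depth l h x + g).
  by constructor 2.
by constructor 3; split=> //; lia.
Qed.

Lemma beyond_zone (x y : 'I_n) : x < l -> pos x < rpos y ->
  zone_size l pos (pos x) h <= beyond G x y.
Proof.
move=> xl xy; rewrite /beyond /zone_size.
rewrite -(big_mkord xpredT (fun w => (rpos w <= pos x) : nat)) -nE big_mkord.
rewrite -sum1dep_card [X in _ <= X]big_mkcond /=; apply: leq_sum => v _.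
have [vx|//] := boolP (rpos v <= pos x).
rewrite (disconnect (s := x)) //; last by right.
by apply: contraTneq vx => ->; rewrite -ltnNge.
Qed.

Lemma separators_seed (x y : 'I_n) : x < l -> y < l ->
  separators G x y \subset [set v : 'I_n | v < l]%SET.
Proof.
move=> xl yl; apply/fintype.subsetP=> s /separators_sub; rewrite inE.
by rewrite !ancestors_seed // !inE => -[/eqP->|/eqP->|/andP[]].
Qed.

Lemma seed_interval_separates (x y : 'I_n) : x < l -> y < l -> pos x < pos y ->
  pos y - pos x < #|separators G x y|.
Proof.
have [oq op] := ord_pos; move=> xl yl xy.
have [yl' _] := op _ yl.
pose f i := q (pos x + i).
have fl i : i < (pos y - pos x).+1 -> f i < l /\ pos (f i) = pos x + i.
  by move=> hi; apply: oq; lia.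
have fn (i : 'I_(pos y - pos x).+1) : f i < n by apply/seed_lt/(proj1 (fl _ _)).
pose F i : 'I_n := Ordinal (fn i).
have F_inj : injective F.
  move=> i j /(congr1 (fun s : 'I_n => pos s)) /=.
  rewrite (proj2 (fl _ _)) // (proj2 (fl _ _)) // => /addnI.
  exact: val_inj.
rewrite -[X in X <= _]card_ord -(card_imset _ F_inj).
apply: subset_leq_card; apply/fintype.subsetP=> _ /imsetP[i _ ->]; rewrite inE.
have [fil pf] := fl i (ltn_ord i).
apply: disconnect => //=; rewrite ?pf.
- by rewrite seed_root_seed // leq_addr.
- by apply: contraTneq xy => ->; rewrite ltnn.
have [/eqP E|ne] := boolP (i == pos y - pos x :> nat).
  left; apply: val_inj; rewrite /= /f E subnKC; last exact: ltnW.
  by rewrite (proj2 (op _ yl)).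
by right; rewrite seed_root_seed //; move: (ltn_ord i) ne; lia.
Qed.

End Separation.

(** * Reading the path from its other end *)

Section Reversal.

Local Open Scope nat_scope.

(** A symmetry device: statements about the zone at the end of the seed follow from those about its
    start. *)
Definition rev_pos (l : nat) (pos : nat -> nat) (x : nat) : nat := l.-1 - pos x.

Lemma seed_order_rev l pos q :
  seed_order l pos q -> seed_order l (rev_pos l pos) (fun i => q (l.-1 - i)).
Proof.
rewrite /rev_pos => -[oq op]; split=> [i il|x xl].
  have [|? ->] := oq (l.-1 - i); first by lia.
  by split=> //; lia.
have [? E] := op x xl; split; first by lia.
by rewrite subKn ?E //; lia.
Qed.

Lemma edge_rev l pos q h x y : seed_order l pos q ->
  edge l (rev_pos l pos) h x y = edge l pos h x y.
Proof.
case=> oq op; elim: h => [|v h /= ->] //=.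
have [xl|] := ltnP x l => //; have [yl|] := ltnP y l => //=.
rewrite /rev_pos; have [] := op _ xl; have [] := op _ yl; lia.
Qed.

End Reversal.

(** * Best pairs lie in the seed *)

Section BestPair.

Local Open Scope nat_scope.

Variables (l n g : nat) (h : seq nat) (pos q : nat -> nat) (G : graph n).
Hypothesis vh : valid l h.
Hypothesis nE : n = size h + l.
Hypothesis ord_pos : seed_order l pos q.
Hypothesis adjE : forall x y : 'I_n, adj G x y = edge l pos h x y.
Hypothesis gl : g.+2 <= l.

Let ms := minn (zone_size l pos g./2 h) (zone_size l (rev_pos l pos) g./2 h).

Lemma central_pair : exists z : 'I_n * 'I_n,
  l - g <= #|separators G z.1 z.2| /\ ms <= score G z.
Proof.
have [oq op] := ord_pos.
(* Trimming g/2 positions at each end leaves at least l - g seed vertices and makes each endpoint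
   cut off a whole zone. *)
have [xl xE] : q g./2 < l /\ pos (q g./2) = g./2 by apply: oq; lia.
have [yl yE] : q (l.-1 - g./2) < l /\ pos (q (l.-1 - g./2)) = l.-1 - g./2.
  by apply: oq; lia.
exists (Ordinal (seed_lt nE xl), Ordinal (seed_lt nE yl)) => /=; split.
  have := @seed_interval_separates l n h pos q G vh nE ord_pos adjE
    (Ordinal (seed_lt nE xl)) (Ordinal (seed_lt nE yl)) xl yl.
  by rewrite /= xE yE; lia.
rewrite /score /ms /= leq_min !geq_min; apply/andP; split; apply/orP.
  left; have := @beyond_zone l n h pos q G vh nE ord_pos adjE
    (Ordinal (seed_lt nE xl)) (Ordinal (seed_lt nE yl)) xl.
  by rewrite /= xE seed_root_seed // yE; apply; lia.
right; have := @beyond_zone l n h (rev_pos l pos) _ G vh nE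
    (seed_order_rev ord_pos) _
    (Ordinal (seed_lt nE yl)) (Ordinal (seed_lt nE xl)) yl.
rewrite /= seed_root_seed // /rev_pos yE xE subKn; last by lia.
apply; last by lia.
by move=> x y; rewrite adjE -(edge_rev _ _ _ ord_pos).
Qed.

(** A best pair scores at least [ms], while a suspicious endpoint cuts off at most its own subtree,
    which is smaller. So both endpoints, and with them the separators, are in the seed. *)
Lemma best_pair_seed :
  (forall u, u < size h + l -> suspicious l h pos g u -> subtree_size l h u < ms) ->
  [/\ exists z, best_pair (l - g) G z
    & forall z, best_pair (l - g) G z ->
        separators G z.1 z.2 \subset [set v : 'I_n | v < l]%SET].
Proof.
move=> Hs; have [z0 [z0k z0s]] := central_pair; split.
  pose P z := l - g <= #|separators G z.1 z.2|.
  case: (@arg_maxnP _ z0 P (score G) z0k) => z Pz zmax.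
  exists z; apply/andP; split; first exact: Pz.
  by apply/forallP=> z'; apply/implyP=> /zmax.
move=> [x y] /andP[/= Pz /forallP/(_ z0)/implyP/(_ z0k)] le0.
have := leq_trans z0s le0; rewrite /score /= leq_min => /andP[sx sy].
have [/andP[xl yl]|[ux xy]|[uy yx]] := suspicious_end vh nE ord_pos adjE gl Pz.
- exact: (separators_seed vh nE ord_pos adjE).
- have lx : l <= x by case/andP: ux.
  have := leq_trans sx (beyond_off vh nE ord_pos adjE lx xy).
  by rewrite leqNgt Hs // -nE.
- have ly : l <= y by case/andP: uy.
  have := leq_trans sy (beyond_off vh nE ord_pos adjE ly yx).
  by rewrite leqNgt Hs // -nE.
Qed.

End BestPair.

(** * Expectation over random histories *)

Section Expectation.

Variables (R : realType) (l : nat).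

(** Mean of [F] over [m] uniform attachments, averaged from the last choice back to the first. *)
Fixpoint expect (m : nat) (F : seq nat -> R) : R :=
  if m is k.+1 then
    expect k (fun h => \sum_(v < k + l) ((k + l)%:R)^-1 * F ((v : nat) :: h))
  else F [::].

Lemma expect_le m (F G : seq nat -> R) :
  (forall h, valid l h -> size h = m -> F h <= G h) -> expect m F <= expect m G.
Proof.
elim: m F G => [|m IH] F G FG /=; first exact: FG.
apply: IH => h vh hm; apply: ler_sum => v _; apply: ler_wpM2l.
  by rewrite invr_ge0 ler0n.
by apply: FG; rewrite /= ?hm // ltn_ord.
Qed.

Lemma expect_eq m (F G : seq nat -> R) :
  (forall h, valid l h -> size h = m -> F h = G h) -> expect m F = expect m G.
Proof.
by move=> FG; apply/eqP; rewrite eq_le !expect_le // => h vh hm; rewrite FG.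
Qed.

Lemma expectD m (F G : seq nat -> R) :
  expect m (fun h => F h + G h) = expect m F + expect m G.
Proof.
elim: m F G => [|m IH] F G //=; rewrite -IH; apply: expect_eq => h _ _.
by rewrite -big_split; apply: eq_bigr => v _; rewrite mulrDr.
Qed.

Lemma expectZ m a (F : seq nat -> R) :
  expect m (fun h => a * F h) = a * expect m F.
Proof.
elim: m F => [|m IH] F //=; rewrite -IH; apply: expect_eq => h _ _.
by rewrite mulr_sumr; apply: eq_bigr => v _; rewrite mulrCA.
Qed.

Lemma expect_martingale m (F : seq nat -> R) : (0 < l)%N ->
  (forall h, valid l h ->
     \sum_(v < size h + l) F ((v : nat) :: h) = (size h + l)%:R * F h) ->
  expect m F = F [::].
Proof.
move=> l0 HF; elim: m => [|m IH] //=; rewrite -[RHS]IH.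
apply: expect_eq => h vh hm; rewrite -mulr_sumr -hm HF // mulKf //.
by rewrite pnatr_eq0 addn_eq0 [l == _]gtn_eqF // andbF.
Qed.

Lemma expect_const m (a : R) : (0 < l)%N -> expect m (fun=> a) = a.
Proof.
move=> l0; rewrite expect_martingale // => h _.
by rewrite sumr_const card_ord mulr_natl.
Qed.

End Expectation.

(** * Sums along the seed and lower bounds on zones *)

Lemma sum_seed_order (V : nmodType) (l : nat) (pos q : nat -> nat) (f : nat -> V) :
  seed_order l pos q -> \sum_(x < l) f (pos x) = \sum_(i < l) f i.
Proof.
case=> oq op; have ql (i : 'I_l) : (q i < l)%N := proj1 (oq _ (ltn_ord i)).
have pl (i : 'I_l) : (pos i < l)%N := proj1 (op _ (ltn_ord i)).
rewrite (reindex (fun i => Ordinal (ql i))) /=; last first.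
  exists (fun i => Ordinal (pl i)) => i _; apply: val_inj => /=.
    exact: (proj2 (oq _ (ltn_ord i))).
  exact: (proj2 (op _ (ltn_ord i))).
by apply: eq_bigr => i _; rewrite (proj2 (oq _ (ltn_ord i))).
Qed.

Lemma sum_leq_ord (l a : nat) : (a < l)%N -> (\sum_(i < l) (i <= a) = a.+1)%N.
Proof.
move=> al; rewrite -(big_mkord xpredT (fun i => (i <= a)%N : nat)).
rewrite (big_cat_nat (n := a.+1)) //= big_nat (eq_bigr (fun=> 1%N)).
  rewrite -big_nat sum_nat_const_nat muln1 subn0 big_nat big1 ?addn0 //.
  by move=> i /andP[ai _]; rewrite leqNgt ai.
by move=> i /andP[_ ia]; rewrite -ltnS ia.
Qed.

(** The zone starts with a + 1 vertices and never shrinks. *)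
Lemma zone_size_gt (l a : nat) (pos q : nat -> nat) h :
  seed_order l pos q -> (a < l)%N -> (a < zone_size l pos a h)%N.
Proof.
move=> ord_pos al; elim: h => [|v h IH]; last first.
  by rewrite zone_size_cons (leq_trans IH) // leq_addr.
rewrite /zone_size /=.
under eq_bigr => w _ do rewrite seed_root_seed //.
by rewrite (sum_seed_order (fun i => (i <= a)%N : nat) ord_pos) sum_leq_ord.
Qed.

(** * The martingale *)

Section Potential.

Variables (R : realType) (l a c : nat) (pos : nat -> nat) (W : nat -> R).
Hypothesis Wzone : forall r, (pos r <= a)%N -> W r = 0.

(* With [p = c + 2] and subtree size [s], the term is
   [2 ^ depth * ((p - 2) * 'C(s + p - 1, p) + 2)]. The constant 2 absorbs the
   terms of the vertices to be born one level deeper, so that the total mass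
   grows by the factor [1 + p / n] in mean, exactly what [1 / 'C(A - 1, p)] loses. *)
Definition vertex_term (h : seq nat) (u : nat) : nat :=
  (2 ^ depth l h u * (c * 'C(subtree_size l h u + c.+1, c.+2) + 2))%N.

Definition mass (h : seq nat) : R :=
  \sum_(u < size h + l) W (seed_root l h u) * (vertex_term h u)%:R.

(** Gain of [mass] on attaching to [v]. By Pascal's rule the binomial of each ancestor grows by 'C(s
    + p - 1, p - 1) with p = c + 2; the last summand is the newborn vertex, with s = 1. *)
Definition increment (h : seq nat) (v : nat) : R :=
  \sum_(u < size h + l) W (seed_root l h u) *
     (2 ^ depth l h u * (c * 'C(subtree_size l h u + c.+1, c.+1)) *
      ((u : nat) \in ancestors l h v))%:R +
  W (seed_root l h v) * (2 ^ (depth l h v).+1 * c.+2)%:R.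

Lemma mass_cons h v : valid l (v :: h) ->
  mass (v :: h) = mass h + increment h v.
Proof.
move=> vh; rewrite /mass /increment /= addSn big_ord_recr /=.
rewrite seed_root_new /vertex_term depth_new subtree_size_new // add1n binn muln1.
rewrite addn2 addrA; congr (_ + _); rewrite -big_split; apply: eq_bigr => u _.
rewrite seed_root_old // depth_old // subtree_size_old //= -mulrDr -natrD.
congr (_ * _%:R); case: (_ \in _); last by rewrite addn0 muln0 addn0.
by rewrite addn1 addSn binS muln1; ring.
Qed.

(** All ancestors of [v] share its root, of weight zero. So attaching inside the zone changes A but
    not the mass. *)
Lemma increment_zone h v : valid l h -> (v < size h + l)%N ->
  (pos (seed_root l h v) <= a)%N -> increment h v = 0.
Proof.
move=> vh hv pv; rewrite /increment Wzone // mul0r addr0 big1 // => u _.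
have [uv|_] := boolP (_ \in _); last by rewrite muln0 mulr0.
by rewrite (seed_root_ancestor vh hv uv) Wzone // mul0r.
Qed.

(** Over all [v], the ancestor terms of [u] use s 'C(s + p - 1, p - 1) = p 'C(s + p - 1, p), and the
    newborn child of [u] adds 2 p 2 ^ depth. Together they are p times the vertex term. *)
Lemma sum_increment h : valid l h ->
  \sum_(v < size h + l) increment h v = c.+2%:R * mass h.
Proof.
move=> vh; rewrite /increment big_split /= exchange_big /= -big_split.
rewrite /mass mulr_sumr; apply: eq_bigr => u _ /=.
rewrite -mulr_sumr -natr_sum -mulrDr -natrD mulrCA -natrM; congr (_ * _%:R).
rewrite -big_distrr /= -/(subtree_size l h u) /vertex_term expnS.
have := mul_bin_left (subtree_size l h u + c.+1) c.+1; rewrite addnK => E.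
have -> : (c.+2 * (2 ^ depth l h u * (c * 'C(subtree_size l h u + c.+1, c.+2) + 2)) =
  2 ^ depth l h u * (c * (c.+2 * 'C(subtree_size l h u + c.+1, c.+2)) + 2 * c.+2))%N.
  by ring.
by rewrite E; ring.
Qed.

Definition potential (h : seq nat) : R :=
  mass h / 'C((zone_size l pos a h).-1, c.+2)%:R.

Hypothesis zone_gt : forall h, (c.+2 < zone_size l pos a h)%N.

(** The A parents inside the zone turn the denominator into 'C(A, p), and A / 'C(A, p) = (A - p) /
    'C(A - 1, p). This loses p times the potential, exactly the gain given by [sum_increment]. *)
Lemma potential_martingale h : valid l h ->
  \sum_(v < size h + l) potential ((v : nat) :: h) = (size h + l)%:R * potential h.
Proof.
move=> vh; set A := zone_size l pos a h.
have gA : (c.+2 < A)%N by exact: zone_gt.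
have C0 : 'C(A.-1, c.+2)%:R != 0 :> R by rewrite pnatr_eq0 -lt0n bin_gt0; lia.
have C1 : 'C(A, c.+2)%:R != 0 :> R by rewrite pnatr_eq0 -lt0n bin_gt0; lia.
have H : A%:R * 'C(A.-1, c.+2)%:R = (A%:R - c.+2%:R) * 'C(A, c.+2)%:R :> R.
  by rewrite -natrB ?(ltnW gA) // -!natrM mul_bin_down.
(* The change splits additively because the increment vanishes whenever the denominator moves. *)
have step (v : 'I_(size h + l)) : potential ((v : nat) :: h) =
   mass h / 'C(A.-1, c.+2)%:R + increment h v / 'C(A.-1, c.+2)%:R +
   (pos (seed_root l h v) <= a)%N%:R *
     (mass h / 'C(A, c.+2)%:R - mass h / 'C(A.-1, c.+2)%:R).
  rewrite /potential zone_size_cons -/A mass_cons /= ?ltn_ord //.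
  have [pv|pv] := boolP (_ <= _)%N; last by rewrite addn0 mul0r addr0 mulrDl.
  by rewrite increment_zone // addn1 /=; ring.
rewrite (eq_bigr _ (fun v _ => step v)) !big_split /=.
rewrite sumr_const card_ord -mulr_suml sum_increment // -mulr_suml -natr_sum.
rewrite -/(zone_size l pos a h) -/A /potential -/A -mulr_natl.
have -> : mass h / 'C(A, c.+2)%:R =
  (A%:R - c.+2%:R) * (mass h / 'C(A.-1, c.+2)%:R) / A%:R.
  have A0 : A%:R != 0 :> R by rewrite pnatr_eq0; lia.
  apply: (mulIf A0); rewrite mulfVK // mulrAC [RHS]mulrA; apply/eqP.
  by rewrite eqr_div // -mulrA H; apply/eqP; ring.
have A0 : A%:R != 0 :> R by rewrite pnatr_eq0; lia.
by field; rewrite A0 C0.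
Qed.

End Potential.

(** Consecutive central binomials have ratio 2 (2 p + 1) / (p + 1) >= 3; the base case p = 5 is 243
    <= 252. *)
Lemma central_bin_ge (p : nat) : (4 < p)%N -> (3 ^ p <= 'C(p.*2, p))%N.
Proof.
elim: p => // p IH; rewrite ltnS leq_eqVlt => /orP[/eqP<- //|p4].
have {}IH := IH p4.
have e1 : 'C(p.+1.*2, p.+1) = ('C(p.*2.+1, p.+1) * 2)%N.
  rewrite doubleS binS -(@bin_sub p.*2.+1 p.+1); last by lia.
  by rewrite (_ : p.*2.+1 - p.+1 = p)%N; lia.
have e2 := mul_bin_diag p.*2.+1 p; rewrite /= in e2.
rewrite e1 expnS -(@leq_pmul2l p.+1) // [X in (_ <= X)%N]mulnA -e2.
by move: IH; move: ('C(_, _)) (3 ^ p)%N => B T; nia.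
Qed.

(** * Probability that a suspicious subtree outgrows a zone *)

Section TailBound.

Variables (R : realType) (l g : nat) (pos q : nat -> nat).
Hypothesis ord_pos : seed_order l pos q.
Hypothesis gl : (g.+2 <= l)%N.

(* Together with the factor [2 ^ depth] of [mass], this gives weight at least one
   to every suspicious vertex, while the total over the seed stays linear in [g]. *)
Definition weight (i : nat) : R := 2^-1 ^+ (i - g) + 2^-1 ^+ (l.-1 - i - g).

(** Vanishing on the zone is what the martingale property asks for ([Wzone]). *)
Definition outer_weight (r : nat) : R :=
  if (pos r <= g./2)%N then 0 else weight (pos r).

Lemma weight_ge0 i : 0 <= weight i.
Proof. by rewrite addr_ge0 // exprn_ge0 // invr_ge0. Qed.

Lemma outer_weight_ge0 r : 0 <= outer_weight r.
Proof. by rewrite /outer_weight; case: ifP => // _; exact: weight_ge0. Qed.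

(** By truncated subtraction the terms with i <= g equal 1; the later ones form a geometric tail of
    sum below 1. *)
Lemma sum_half_pow n : \sum_(i < n) 2^-1 ^+ (i - g) <= g.+2%:R :> R.
Proof.
have H r : \sum_(i < g.+1 + r) 2^-1 ^+ (i - g) = g.+2%:R - 2^-1 ^+ r :> R.
  elim: r => [|r IH]; last first.
    rewrite addnS big_ord_recr /= IH (_ : g.+1 + r - g = r.+1)%N; last by lia.
    by rewrite exprS; lra.
  rewrite addn0 expr0 (eq_bigr (fun=> 1)).
    by rewrite sumr_const card_ord [g.+2%:R]mulrSr addrK.
  by move=> i _; rewrite (_ : i - g = 0)%N //; have := ltn_ord i; lia.
have M : \sum_(i < n) 2^-1 ^+ (i - g) <= \sum_(i < g.+1 + n) 2^-1 ^+ (i - g) :> R.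
  rewrite -!(big_mkord xpredT (fun i => 2^-1 ^+ (i - g) : R)).
  rewrite (big_cat_nat (n := n) (p := g.+1 + n)) ?leq_addl //= lerDl.
  by apply: sumr_ge0 => i _; apply: exprn_ge0; rewrite invr_ge0.
apply: le_trans M _; rewrite H lerBlDr lerDl exprn_ge0 // invr_ge0 //.
Qed.

Lemma sum_weight : \sum_(i < l) weight i <= 2 * g.+2%:R.
Proof.
rewrite /weight big_split /= mulr_natl mulr2n; apply: lerD.
  exact: sum_half_pow.
rewrite (reindex_inj rev_ord_inj) /=.
rewrite (eq_bigr (fun i : 'I_l => 2^-1 ^+ (i - g))); first exact: sum_half_pow.
by move=> i _; congr (_ ^+ (_ - _)); have := ltn_ord i; lia.
Qed.

(* A suspicious vertex whose subtree outgrows the zone has its root outside the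
   zone, hence an unsuppressed weight. *)
Lemma potential_ge (c u : nat) h :
  valid l h -> (u < size h + l)%N -> suspicious l h pos g u ->
  (zone_size l pos g./2 h <= subtree_size l h u)%N ->
  (c.+2 < zone_size l pos g./2 h)%N ->
  c%:R <= potential l g./2 c pos outer_weight h.
Proof.
move=> vh hu /andP[lu su] zu zc.
have pu : (pos (seed_root l h u) <= g./2)%N = false.
  apply/negP => pu; have := @subtree_size_zone l pos g./2 h u vh.
  by rewrite lu hu => /(_ isT pu); rewrite ltnNge zu.
have C0 : 0 < 'C((zone_size l pos g./2 h).-1, c.+2)%:R :> R.
  by rewrite ltr0n bin_gt0; lia.
rewrite /potential ler_pdivlMr // /mass (bigD1 (Ordinal hu)) //=.
apply: le_trans (_ : outer_weight (seed_root l h u) * (vertex_term l c h u)%:R <= _);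
  last first.
  rewrite lerDl sumr_ge0 // => v _.
  by rewrite mulr_ge0 ?outer_weight_ge0.
rewrite /outer_weight pu /vertex_term natrM mulrA.
(* The end of the seed nearer to the root contributes at least 2 ^ (- depth). *)
have w1 : 1 <= weight (pos (seed_root l h u)) * (2 ^ depth l h u)%:R.
  have half k : (k <= depth l h u)%N -> 1 <= 2^-1 ^+ k * (2 ^ depth l h u)%:R :> R.
    move=> kd; rewrite natrX -(subnK kd) exprD mulrCA -exprMn mulVf //.
    by rewrite expr1n mulr1 exprn_ege1 // ler1n.
  rewrite /weight mulrDl.
  have nn k : 0 <= 2^-1 ^+ k * (2 ^ depth l h u)%:R :> R.
    by rewrite mulr_ge0 // exprn_ge0 // invr_ge0.
  move: su; rewrite geq_min => /orP[su|su].
    by apply: ler_wpDr; rewrite ?nn // half //; lia.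
  by apply: ler_wpDl; rewrite ?nn // half //; lia.
rewrite -[X in X <= _]mul1r -natrM; apply: ler_pM => //.
(* Drop the constant 2 and use s + p - 1 >= A - 1. *)
rewrite ler_nat; apply: leq_trans (leq_addr _ _); rewrite leq_mul //.
by apply: leq_bin2l; lia.
Qed.

(** At the start each seed vertex has depth 0 and subtree size 1, so its term is p = c + 2, and A -
    1 = g/2. *)
Lemma potential_nil (c : nat) :
  potential l g./2 c pos outer_weight [::] <=
  c.+2%:R * (2 * g.+2%:R) / 'C(g./2, c.+2)%:R.
Proof.
rewrite /potential.
have -> : zone_size l pos g./2 [::] = g./2.+1.
  rewrite /zone_size /=; under eq_bigr => w _ do rewrite seed_root_seed //.
  rewrite (sum_seed_order (fun i => (i <= g./2)%N : nat) ord_pos) sum_leq_ord //.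
  by lia.
rewrite ler_wpM2r ?invr_ge0 // /mass /=.
apply: le_trans (_ : \sum_(u < l) c.+2%:R * weight (pos u) <= _).
  apply: ler_sum => u _; rewrite seed_root_seed // /vertex_term depth_seed //.
  have -> : subtree_size l [::] u = 1%N.
    rewrite /subtree_size /= (bigD1 (Ordinal (ltn_ord u))) //= inE eqxx big1 //.
    move=> w wu; rewrite inE; case: eqP => // E; case/eqP: wu.
    exact: val_inj.
  rewrite add1n binn muln1 expn0 mul1n addn2 mulrC ler_wpM2l //.
  by rewrite /outer_weight; case: ifP => // _; exact: weight_ge0.
rewrite -mulr_sumr ler_wpM2l // (sum_seed_order weight ord_pos).
exact: sum_weight.
Qed.

Lemma expect_suspicious m (p := (g %/ 4)%N) : (4 < p)%N ->
  expect l m (fun h => [exists u : 'I_(size h + l), suspicious l h pos g u &&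
     (zone_size l pos g./2 h <= subtree_size l h u)%N]%:R) <=
  4 * g.+2%:R / 3 ^+ p :> R.
Proof.
move=> p4; pose c := (p - 2)%N; have pE : c.+2 = p by rewrite /c; lia.
have ag : (g./2 < l)%N by lia.
have zc h : (c.+2 < zone_size l pos g./2 h)%N.
  by apply: leq_ltn_trans (zone_size_gt h ord_pos ag); rewrite pE /p; lia.
have c0 : 0 < c%:R :> R by rewrite ltr0n /c; lia.
pose F h := potential l g./2 c pos outer_weight h.
apply: le_trans (_ : expect l m (fun h => c%:R^-1 * F h) <= _).
  (* Markov's inequality: by [potential_ge] the indicator is at most [F h / c]. *)
  apply: expect_le => h vh _; case: existsP => [[u /andP[su zu]]|_] /=.
    by rewrite ler_pdivlMl // mulr1 (potential_ge vh (ltn_ord u)).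
  rewrite mulr_ge0 ?invr_ge0 // /F /potential mulr_ge0 ?invr_ge0 //.
  by apply: sumr_ge0 => u _; rewrite mulr_ge0 ?outer_weight_ge0.
rewrite expectZ expect_martingale; first last.
- move=> h vh; apply: potential_martingale => //.
  by move=> r pr; rewrite /outer_weight pr.
- by lia.
rewrite ler_pdivrMl //; apply: le_trans (potential_nil c) _.
(* Since p is g/4 rounded down, g/2 >= 2 p. *)
have Cp : 3 ^+ p <= 'C(g./2, c.+2)%:R :> R.
  rewrite -natrX ler_nat pE; apply: leq_trans (central_bin_ge p4) _.
  by apply: leq_bin2l; rewrite /p; lia.
have p3 : 0 < 3 ^+ p :> R by rewrite exprn_gt0.
rewrite !mulrA ler_pM ?invr_ge0 //; last first.
  by rewrite lef_pV2 ?posrE // (lt_le_trans p3).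
(* What remains is 2 p <= 4 (p - 2). *)
rewrite ler_wpM2r // -!natrM ler_nat /c; lia.
Qed.

End TailBound.

(** * Ordering the vertices of a path *)

Lemma eq_set2 (T : finType) (a b x y : T) :
  ([set x; y]%SET == [set a; b]%SET) =
  (x == a) && (y == b) || (x == b) && (y == a).
Proof.
apply/eqP/idP => [E|]; last first.
  by case/orP=> /andP[/eqP-> /eqP->] //; rewrite finset.setUC.
have : y \in [set a; b]%SET by rewrite -E finset.set22.
have : x \in [set a; b]%SET by rewrite -E finset.set21.
have : b \in [set x; y]%SET by rewrite E finset.set22.
have : a \in [set x; y]%SET by rewrite E finset.set21.
rewrite !inE ![a == _]eq_sym ![b == _]eq_sym.
by do 4!case: eqP => //=; move=> *; subst; rewrite ?eqxx.
Qed.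

Section PathSeed.

Variables (l : nat) (P : graph l).
Hypothesis l2 : (1 < l)%N.
Hypothesis Ppath : is_path P.

Local Notation nb x := [set y | adj P x y]%SET.

Lemma degree_neighbours x : degree P x = #|nb x|.
Proof.
have [[_ P2 _ _] _ _] := Ppath.
have inj : {in nb x &, injective (fun y => [set x; y]%SET)}.
  move=> y z; rewrite !inE => xy _ /eqP; rewrite eq_set2 eqxx /=.
  case/orP=> [/eqP//|/andP[/eqP xz /eqP yx]].
  by rewrite -xz yx.
rewrite -(card_in_imset inj) /degree; apply: eq_card => e; rewrite inE.
apply/andP/imsetP => [[eP xe]|[y]]; last first.
  by rewrite inE => xy ->; split=> //; rewrite !inE eqxx.
have /eqP/cards2P[a [b [ab E]]] := P2 e eP; move: xe; rewrite E !inE.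
case/orP=> /eqP->; first by exists b => //; rewrite inE /adj -E.
by exists a; [rewrite inE /adj finset.setUC -E | rewrite finset.setUC].
Qed.

(** The vertices of degree one or two number 2 + (l - 2) = l, hence are all vertices. *)
Lemma degree_le2 x : (degree P x <= 2)%N.
Proof.
have [_ D1 D2] := Ppath.
pose A := [set v | degree P v == 1%N]%SET; pose B := [set v | degree P v == 2%N]%SET.
have AB : A :&: B = finset.set0.
  by apply/setP=> v; rewrite !inE; case: eqP => // ->.
have : x \in (A :|: B)%SET.
  suff -> : (A :|: B)%SET = [set: 'I_l]%SET by rewrite inE.
  apply/eqP; rewrite eqEcard finset.subsetT cardsT card_ord.
  by rewrite cardsU AB finset.cards0 D1 D2; lia.
by rewrite !inE => /orP[] /eqP->.
Qed.

(** Take a longest simple path [s] from a vertex of degree one. The degree bounds allow its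
    non-final vertices no further neighbours, and maximality allows the last one none outside [s].
    So [s] is closed under adjacency, and by connectedness it visits every vertex. *)
Lemma path_enumeration : exists s : seq 'I_l,
  [/\ uniq s, (forall x, x \in s) &
      forall x y, adj P x y =
        (index x s == (index y s).+1) || (index y s == (index x s).+1)].
Proof.
have [[_ P2 Pc _] D1 _] := Ppath.
have irr x : ~~ adj P x x.
  apply/negP => /P2; rewrite finset.setUid finset.cards1; lia.
have /card_gt0P[x0] : (0 < #|[set v | degree P v == 1%N]%SET|)%N by rewrite D1.
rewrite inE => /eqP dx0.
pose Q k := [exists p : k.-tuple 'I_l, path (adj P) x0 p && uniq (x0 :: p)].
have exQ : exists k, Q k by exists 0%N; apply/existsP; exists [tuple].
have leQ k : Q k -> (k <= l)%N.
  case/existsP=> p /andP[_ up].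
  have := card_uniqP up; rewrite /= size_tuple => E.
  by have := max_card (mem (x0 :: p)); rewrite E card_ord; lia.
case: (ex_maxnP exQ leQ) => k /existsP[p /andP[pp up]] kmax.
set s := x0 :: p in up; have sE : size s = k.+1 by rewrite /= size_tuple.
have adjS i : (i.+1 < size s)%N -> adj P (nth x0 s i) (nth x0 s i.+1).
  move=> hi; exact: (path.pathP x0 pp).
have neq i j : (i < size s)%N -> (j < size s)%N ->
    (nth x0 s i == nth x0 s j) = (i == j).
  by move=> hi hj; rewrite nth_uniq.
have key i z : (i.+1 < size s)%N -> adj P (nth x0 s i) z ->
    z = nth x0 s i.+1 \/ (0 < i)%N /\ z = nth x0 s i.-1.
  move=> hi az; have [->|nz] := eqVneq z (nth x0 s i.+1); [by left|right].
  case: i hi az nz => [|i] hi az nz.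
    have : (#|[set z; nth x0 s 1]%SET| <= #|nb x0|)%N.
      apply: subset_leq_card; apply/fintype.subsetP=> w; rewrite !inE.
      by case/orP=> /eqP->; [exact: az | exact: (adjS 0%N)].
    by rewrite cards2 nz -degree_neighbours dx0.
  split=> //; apply/eqP; apply: contraT => nz' /=.
  have : (#|z |: [set nth x0 s i; nth x0 s i.+2]|%SET <= #|nb (nth x0 s i.+1)|)%N.
    apply: subset_leq_card; apply/fintype.subsetP=> w; rewrite !inE.
    case/or3P=> /eqP->; [exact: az | | exact: adjS].
    by rewrite adj_sym; apply: adjS; apply: ltnW.
  rewrite cardsU1 !inE negb_or nz' nz cards2 neq //; last by lia.
  by rewrite -degree_neighbours; have := degree_le2 (nth x0 s i.+1); lia.
have closedS y z : y \in s -> adj P y z -> z \in s.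
  move=> ys yz; have hi : (index y s < size s)%N by rewrite index_mem.
  have yE : nth x0 s (index y s) = y by rewrite nth_index.
  have [hi'|hi'] := ltnP (index y s).+1 (size s).
    rewrite -yE in yz; case: (key _ _ hi' yz) => [->|[_ ->]]; apply: mem_nth => //.
    exact: leq_ltn_trans (leq_pred _) hi.
  apply: contraT => zs; exfalso.
  have lastE : last x0 p = y.
    by rewrite -yE (last_nth x0) -/s; congr nth; rewrite size_tuple; lia.
  have : Q k.+1.
    apply/existsP; exists [tuple of rcons p z].
    rewrite /= rcons_path pp lastE yz /= mem_rcons rcons_uniq.
    by move: zs up; rewrite /s /= !inE negb_or eq_sym => /andP[/negPf-> ->] /andP[-> ->].
  by move/kmax; rewrite ltnn.
have allS y : y \in s.
  have /connectP[r] := Pc x0 y.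
  have : x0 \in s by rewrite inE eqxx.
  elim: r (x0) => [|w r IH] u us /=; first by move=> _ ->.
  by case/andP=> uw; apply: IH; apply: closedS uw.
exists s; split=> // x y.
wlog xy : x y / (index x s <= index y s)%N => [W|].
  by case/orP: (leq_total (index x s) (index y s)) => /W // H; rewrite adj_sym H orbC.
have hx : (index x s < size s)%N by rewrite index_mem.
have hy : (index y s < size s)%N by rewrite index_mem.
have [xE yE] : nth x0 s (index x s) = x /\ nth x0 s (index y s) = y.
  by rewrite !nth_index.
apply/idP/orP => [axy|[|]]; last 2 first.
- by move=> /eqP E; move: xy; rewrite E ltnn.
- by move=> /eqP E; rewrite -xE -yE E; apply: adjS; rewrite -E.
right; move: xy; rewrite leq_eqVlt => /orP[/eqP E|xy].
  by move: axy; rewrite -xE E yE (negPf (irr y)).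
rewrite -xE in axy; case: (key _ _ (leq_ltn_trans xy hy) axy) => [E|[i0 E]].
  by rewrite E index_uniq // (leq_ltn_trans xy hy).
move: xy; rewrite E index_uniq //; first by rewrite ltnNge leq_pred.
exact: leq_ltn_trans (leq_pred _) hx.
Qed.

Lemma path_seed_order : exists pos q, seed_order l pos q /\
  forall x y : 'I_l, adj P x y = edge l pos [::] x y.
Proof.
have [s [us allS adjE]] := path_enumeration.
pose t := map (@nat_of_ord l) s.
have ut : uniq t by rewrite map_inj_uniq //; exact: val_inj.
have st : size t = l.
  by rewrite size_map -(card_uniqP us) -[RHS]card_ord; apply: eq_card => x; rewrite allS.
have mt x : (x \in t) = (x < l)%N.
  apply/mapP/idP => [[i _ ->]|xl]; first exact: ltn_ord.
  by exists (Ordinal xl).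
exists (fun x => index x t), (fun i => nth 0%N t i); split.
  split=> [i il|x xl]; first by rewrite -mt mem_nth ?st // index_uniq ?st.
  have xt : x \in t by rewrite mt.
  by rewrite nth_index //; split=> //; rewrite -st index_mem.
by move=> x y; rewrite adjE /= !ltn_ord /= !index_map //; exact: val_inj.
Qed.

End PathSeed.

(** * From histories to random trees *)

Section Coupling.

Variables (R : realType) (l : nat) (pos : nat -> nat).

Definition realizes (n : nat) (t : graph n) (h : seq nat) : Prop :=
  forall x y : 'I_n, adj t x y = edge l pos h x y.

Lemma realizes_attach n (t : graph n) h (v : 'I_n) :
  valid l h -> (size h + l)%N = n -> realizes t h -> realizes (attach t v) ((v : nat) :: h).
Proof.
move=> vh hn th x y; rewrite /adj /attach !inE eq_set2 /= hn -!val_eqE /=.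
rewrite -orbA [(_ == v :> nat) && _]andbC; congr [|| _, _ | _].
have winj : injective (widen_ord (leqnSn n)) by move=> i j [] /val_inj.
apply/imsetP/idP => [[e et E]|exy].
  have /imsetP[x' x'e xE] : x \in widen_ord (leqnSn n) @: e by rewrite -E !inE eqxx.
  have /imsetP[y' y'e yE] : y \in widen_ord (leqnSn n) @: e by rewrite -E !inE eqxx orbT.
  have -> : edge l pos h x y = adj t x' y' by rewrite th xE yE.
  rewrite /adj; suff -> : [set x'; y']%SET = e by [].
  by apply: (imset_inj winj); rewrite -E imsetU !imset_set1 xE yE.
have /andP[] := edge_lt vh exy; rewrite hn => xn yn.
exists [set Ordinal xn; Ordinal yn]%SET.
  by have := th (Ordinal xn) (Ordinal yn); rewrite /= exy.
by rewrite imsetU !imset_set1; congr [set _; _]%SET; apply: val_inj.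
Qed.

Lemma ua_law_ge0 (P : graph l) m (t : graph (m + l)) : 0 <= ua_law R P t.
Proof.
elim: m t => [|m IH] t /=; first by case: (_ == _).
apply: sumr_ge0 => t' _; apply: mulr_ge0 => //; apply: sumr_ge0 => v _.
by rewrite mulr_ge0 // invr_ge0.
Qed.

(** Histories and trees grow by the same uniform choices, so a bound on realizing pairs passes to
    the means. The induction averages out the last attachment on both sides. *)
Lemma expect_le_ua_law (P : graph l) m (K : seq nat -> R) (F : graph (m + l) -> R) :
  realizes P [::] ->
  (forall h t, valid l h -> size h = m -> realizes t h -> K h <= F t) ->
  expect l m K <= \sum_(t : graph (m + l)) ua_law R P t * F t.
Proof.
move=> HP; elim: m K F => [|m IH] K F KF.
  rewrite /= (bigD1 (P : graph (0 + l))) //= eqxx mul1r big1 ?addr0; first exact: KF.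
  by move=> t /negPf->; rewrite mul0r.
pose F' t' := \sum_(v : 'I_(m + l)) (m + l)%:R^-1 * F (attach t' v).
have -> : \sum_(t : graph (m.+1 + l)) ua_law R P t * F t =
          \sum_(t' : graph (m + l)) ua_law R P t' * F' t'.
  under eq_bigr => t _ do rewrite /= mulr_suml.
  rewrite exchange_big /=; apply: eq_bigr => t' _; rewrite /F'.
  under eq_bigr => t _ do rewrite -mulrA mulr_suml.
  rewrite -mulr_sumr exchange_big /=; congr (_ * _); apply: eq_bigr => v _.
  rewrite (bigD1 (attach t' v : graph (m.+1 + l))) //= eqxx mulr1 big1 ?addr0 //.
  by move=> t /negPf->; rewrite mulr0 mul0r.
apply: IH => h t vh hm th; apply: ler_sum => v _; apply: ler_wpM2l.
  by rewrite invr_ge0.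
apply: KF => /=; rewrite ?hm ?ltn_ord //.
by apply: realizes_attach; rewrite ?hm.
Qed.

End Coupling.

(** * Invariance under relabelling *)

Section Relabel.

Variables (n : nat) (s : 'S_n) (t : graph n).

Lemma adj_relabel x y : adj (relabel s t) (s x) (s y) = adj t x y.
Proof.
rewrite /adj /relabel.
have -> : [set s x; s y]%SET = s @: [set x; y]%SET by rewrite imsetU !imset_set1.
by rewrite mem_imset //; apply: imset_inj; exact: perm_inj.
Qed.

Lemma connect_relabel z x y :
  connect (avoid (relabel s t) (s z)) (s x) (s y) = connect (avoid t z) x y.
Proof.
have E : relpre s (avoid (relabel s t) (s z)) =2 avoid t z.
  by move=> u w; rewrite /avoid /= adj_relabel !(inj_eq perm_inj).
apply/connectP/connectP => -[p pp yE].
  exists (map (s^-1)%g p).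
    by rewrite -(eq_path E) -path_map -map_comp (eq_map (permKV s)) map_id.
  by apply: (@perm_inj _ s); rewrite -last_map -map_comp (eq_map (permKV s)) map_id.
exists (map s p); first by rewrite path_map (eq_path E).
by rewrite last_map -yE.
Qed.

Lemma separators_relabel x y :
  separators (relabel s t) (s x) (s y) = (s @: separators t x y)%SET.
Proof.
apply/setP=> z; rewrite -[z](permKV s) mem_imset; last exact: perm_inj.
by rewrite !inE connect_relabel.
Qed.

Lemma beyond_relabel x y : beyond (relabel s t) (s x) (s y) = beyond t x y.
Proof.
rewrite /beyond -[RHS](card_imset _ (@perm_inj _ s)); apply: eq_card => v.
rewrite -[v](permKV s) mem_imset; last exact: perm_inj.
by rewrite !inE connect_relabel.
Qed.

Lemma score_relabel z : score (relabel s t) (s z.1, s z.2) = score t z.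
Proof. by rewrite /score !beyond_relabel. Qed.

Lemma best_pair_relabel k z :
  best_pair k (relabel s t) (s z.1, s z.2) = best_pair k t z.
Proof.
rewrite /best_pair separators_relabel card_imset; last exact: perm_inj.
congr (_ && _); rewrite score_relabel; apply/forallP/forallP => H z'.
  have := H (s z'.1, s z'.2).
  by rewrite separators_relabel card_imset ?score_relabel //; exact: perm_inj.
have := H ((s^-1)%g z'.1, (s^-1)%g z'.2).
rewrite -score_relabel /= -(card_imset (mem (separators _ _ _)) (@perm_inj _ s)).
by rewrite -separators_relabel !permKV -surjective_pairing.
Qed.

End Relabel.

(** * The algorithm and its success event *)

Section Algorithm.

Variables (R : realType) (l m k : nat).

(** The default, all vertices, keeps the output large when there is no best pair. *)
Definition find_seed (t : graph (m + l)) : {set 'I_(m + l)} :=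
  if [pick z | best_pair k t z] is Some z then separators t z.1 z.2 else finset.setT.

Definition find_seed_law (t : graph (m + l)) (H : {set 'I_(m + l)}) : R :=
  (H == find_seed t)%:R.

(** On the relabelled tree [pick] may select any best pair, so all of them must be good. *)
Definition recoverable (t : graph (m + l)) : bool :=
  [exists z, best_pair k t z] &&
  [forall z, best_pair k t z ==> (separators t z.1 z.2 \subset seed_vertices l m)].

Lemma find_seed_card t : (k <= l)%N -> (k <= #|find_seed t|)%N.
Proof.
move=> kl; rewrite /find_seed; case: pickP => [z /andP[] //|_].
by rewrite cardsT card_ord (leq_trans kl) // leq_addl.
Qed.

Lemma found_set_recoverable t (s : 'S_(m + l)) : recoverable t ->
  found_set (t, s, find_seed (relabel s t)) \subset seed_vertices l m.
Proof.
case/andP=> /existsP[z0 z0b] /forallP tb; rewrite /found_set /find_seed.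
case: pickP => [z zb|/(_ (s z0.1, s z0.2))]; last by rewrite (best_pair_relabel s t k z0) z0b.
pose z' := ((s^-1)%g z.1, (s^-1)%g z.2).
have zE : z = (s z'.1, s z'.2) by rewrite /z' !permKV -surjective_pairing.
have z'b : best_pair k t z' by rewrite -(best_pair_relabel s) -zE.
have := implyP (tb z') z'b; rewrite [in X in _ -> X]zE separators_relabel /=.
by rewrite -imset_comp (eq_imset _ (permK s)) imset_id.
Qed.

(** On a recoverable tree the algorithm succeeds for every permutation, so averaging over
    permutations keeps the full mass of the tree. *)
Lemma recoverable_le_prob (P : graph l) :
  \sum_(t : graph (m + l)) ua_law R P t * (recoverable t)%:R <=
  prob_found_in_seed P find_seed_law.
Proof.
rewrite /prob_found_in_seed [leRHS]big_mkcond /=.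
pose X w := if found_set w \subset seed_vertices l m
  then joint_law P find_seed_law w else 0.
rewrite -[leRHS]/(\sum_w X w).
have -> : \sum_w X w = \sum_t \sum_s \sum_K X (t, s, K).
  by rewrite pair_bigA pair_bigA; apply: eq_bigr => -[[]].
rewrite /X {X}.
apply: ler_sum => t _.
have n0 : #|{: 'S_(m + l)}|%:R != 0 :> R.
  by rewrite pnatr_eq0 -lt0n; apply/card_gt0P; exists 1%g.
have -> : ua_law R P t * (recoverable t)%:R = \sum_(s : 'S_(m + l))
    ua_law R P t * #|{: 'S_(m + l)}|%:R^-1 * (recoverable t)%:R.
  by rewrite sumr_const -[RHS]mulr_natr mulrAC mulfVK.
apply: ler_sum => s _.
have w0 K : 0 <= joint_law P find_seed_law (t, s, K).
  by rewrite /joint_law !mulr_ge0 ?ua_law_ge0 ?invr_ge0.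
have [tr|_] := boolP (recoverable t); last first.
  by rewrite mulr0 sumr_ge0 // => K _; case: ifP => // _; exact: (w0 K).
rewrite (bigD1 (find_seed (relabel s t))) //= found_set_recoverable //.
rewrite /joint_law /find_seed_law eqxx lerDl sumr_ge0 // => K _.
by case: ifP => // _; exact: (w0 K).
Qed.

End Algorithm.

(** * Probability of recovery *)

Lemma suspicious_rev l pos q g h u : seed_order l pos q -> valid l h ->
  (u < size h + l)%N -> suspicious l h (rev_pos l pos) g u = suspicious l h pos g u.
Proof.
move=> [_ op] vh hu; rewrite /suspicious /rev_pos minnC; congr (_ && (minn _ _ <= _)%N).
by have [] := op _ (seed_root_lt vh hu); lia.
Qed.

Lemma recoverable_prob (R : realType) (l m g : nat) (P : graph l) :
  is_path P -> (g.+2 <= l)%N -> (4 < g %/ 4)%N ->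
  1 - 8 * g.+2%:R / 3 ^+ (g %/ 4) <=
  \sum_(t : graph (m + l)) ua_law R P t * (recoverable (l - g) t)%:R.
Proof.
move=> PP gl g4.
have l1 : (1 < l)%N by lia.
have [pos [q [ord_pos adjE]]] := path_seed_order l1 PP.
pose bad (p : nat -> nat) (h : seq nat) : bool :=
  [exists u : 'I_(size h + l), suspicious l h p g u &&
     (zone_size l p g./2 h <= subtree_size l h u)%N].
(* Union bound over the two ends of the seed: [K] is at most the indicator that neither is bad. *)
pose K h : R := 1 + -1 * ((bad pos h)%:R + (bad (rev_pos l pos) h)%:R).
apply: (@le_trans _ _ (expect l m K)).
  rewrite /K expectD expect_const ?expectZ ?expectD; last by lia.
  have := @expect_suspicious R l g pos q ord_pos gl m g4.
  have := @expect_suspicious R l g (rev_pos l pos) _ (seed_order_rev ord_pos) gl m g4.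
  set X := expect _ _ _; set Y := expect _ _ _; set Z := _ / _ => HX HY.
  rewrite -/X -/Y.
  have -> : 8 * g.+2%:R / 3 ^+ (g %/ 4) = 2 * Z by rewrite /Z; ring.
  by lra.
apply: (@expect_le_ua_law R l pos P m K (fun t => (recoverable (l - g) t)%:R)).
  exact: adjE.
move=> h t vh hm ht; rewrite /K.
have [b1|nb1] := boolP (bad pos h).
  by case: (bad _ h); case: recoverable => /=; lra.
have [b2|nb2] := boolP (bad (rev_pos l pos) h).
  by case: recoverable => /=; lra.
rewrite (_ : recoverable _ t); first by rewrite /=; lra.
have [] := @best_pair_seed l (m + l) g h pos q t vh _ ord_pos ht gl.
- by rewrite hm.
- move=> u hu su; rewrite leq_min; apply/andP; split; rewrite ltnNge.
    apply: contra nb1 => zu; apply/existsP; exists (Ordinal hu).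
    by rewrite /= su.
  apply: contra nb2 => zu; apply/existsP; exists (Ordinal hu).
  by rewrite /= (suspicious_rev _ ord_pos) // su.
move=> [z zb] H; apply/andP; split; first by apply/existsP; exists z.
by apply/forallP=> z'; apply/implyP => /H.
Qed.

(** * Numerical estimates and the choice of g *)

Section Constants.

Variable R : realType.

Lemma expR1_le4 : expR 1 <= 4 :> R.
Proof.
have h : 2^-1 <= expR (- 2^-1) :> R by have := expR_ge1Dx (- 2^-1 : R); lra.
have : expR 1 = (expR (- 2^-1))^-1 ^+ 2 :> R.
  by rewrite -expRN opprK -expRM_natl; congr expR; lra.
move=> ->; have : (expR (- 2^-1))^-1 <= 2 :> R.
  by rewrite -[leRHS]invrK lef_pV2 ?posrE ?expR_gt0 ?invr_gt0.
have : 0 <= (expR (- 2^-1))^-1 :> R by rewrite invr_ge0 expR_ge0.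
by move: (_^-1) => y; nra.
Qed.

(** The bound e ^ x >= 1 + x at x = 1/8 suffices: (9 / 8) ^ 16 is about 6.58. *)
Lemma expR1_sqr_ge : 13 / 2 <= expR 1 ^+ 2 :> R.
Proof.
have h : 9 / 8 <= expR (8^-1) :> R by have := expR_ge1Dx (8^-1 : R); lra.
have -> : expR 1 ^+ 2 = expR (8^-1) ^+ 16 :> R.
  by rewrite -!expRM_natl; congr expR; lra.
by apply: le_trans (_ : (9 / 8) ^+ 16 <= _); [lra | rewrite lerXn2r ?nnegrE //; lra].
Qed.

Lemma expR_third_le : expR (3^-1) <= 3 / 2 :> R.
Proof.
have h : 2 / 3 <= expR (- 3^-1) :> R by have := expR_ge1Dx (- 3^-1 : R); lra.
rewrite -[3^-1]opprK expRN -[leRHS]invrK invf_div.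
by rewrite lef_pV2 ?posrE ?expR_gt0 //; lra.
Qed.

Lemma ln4_ge1 : 1 <= ln 4 :> R.
Proof. by rewrite -[leLHS]expRK ler_ln ?posrE ?expR_gt0 // expR1_le4. Qed.

End Constants.

Lemma pow2_ge_linear p : (9 <= p)%N -> (12 * (4 * p + 5) <= 2 ^ p)%N.
Proof.
elim: p => // p IH; rewrite ltnS leq_eqVlt => /orP[/eqP<- //|p9].
by rewrite expnS; have := IH p9; lia.
Qed.

Lemma seed_constants (R : realType) (eps gamma : R) (l : nat) :
  0 < eps -> 0 < gamma -> gamma < 1 -> (0 < l)%N ->
  Num.max (2 * expR 1 ^+ 2 / gamma * ln (1 / eps))
          (2 * expR 1 ^+ 2 / gamma * ln (4 * expR 1 ^+ 2)) <= l%:R ->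
  exists g : nat, [/\ (g.+2 <= l)%N, (4 < g %/ 4)%N,
    (1 - gamma) * l%:R <= (l - g)%:R & 8 * g.+2%:R / 3 ^+ (g %/ 4) <= eps].
Proof.
move=> e0 y0 y1 l0; rewrite ge_max => /andP[].
rewrite ![_ / gamma * _]mulrAC !ler_pdivrMr // [_ * gamma]mulrC => H1 H2.
have E := expR1_sqr_ge R.
(* Here 2 e ^ 2 >= 13 and ln (4 e ^ 2) = ln 4 + 2 >= 3. *)
have L39 : 39 <= gamma * l%:R.
  apply: le_trans H2; rewrite lnM ?posrE ?exprn_gt0 ?expR_gt0 //.
  rewrite lnXn ?expR_gt0 // expRK; have := ln4_ge1 R.
  by move: (ln 4) (expR 1 ^+ 2) E => x y; nra.
have Ll : gamma * l%:R <= l%:R by rewrite ler_piMl // ltW.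
have l39 : (39 <= l)%N by rewrite -(ler_nat R); lra.
(* The cap l - 2 ensures g + 2 <= l and still leaves gamma l <= g + 2. *)
pose f := Num.truncn (gamma * l%:R); pose g := minn f (l - 2).
have /andP[f1 f2] : f%:R <= gamma * l%:R < f.+1%:R.
  by apply: truncn_itv; lra.
have gl : (g.+2 <= l)%N by move: l39; rewrite /g; clear; lia.
have gL : gamma * l%:R <= g.+2%:R.
  rewrite /g; case: (leqP f (l - 2)) => fl.
    by rewrite (le_trans (ltW f2)) // ler_nat.
  by rewrite (le_trans Ll) // ler_nat; move: l39; clear; lia.
have g37 : (37 <= g)%N.
  have : 39%:R <= g.+2%:R :> R by lra.
  by rewrite ler_nat.
have gf : g%:R <= gamma * l%:R by apply: le_trans f1; rewrite ler_nat geq_minl.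
clearbody g; clear f f1 f2.
exists g; split=> //; first by move: g37; clear; lia.
  by rewrite natrB; [lra | apply: leq_trans gl; rewrite ltnW].
set p := (g %/ 4)%N.
have p9 : (9 <= p)%N by rewrite /p; move: g37; clear; lia.
have gp : (g.+2 <= 4 * p + 5)%N by rewrite /p; clear; lia.
(* Since 13 ln (1 / eps) <= gamma l <= g + 2 <= 4 p + 5, this follows from 3 (4 p + 5) <= 13 (p +
   1). *)
have lnle : ln (1 / eps) <= p.+1%:R * 3^-1.
  have [n|n] := leP (ln (1 / eps)) 0; first by apply: le_trans n _; rewrite mulr_ge0.
  have : 13 * ln (1 / eps) <= (4 * p + 5)%:R.
    rewrite -(ler_nat R) in gp.
    by move: (ln (1 / eps)) (expR 1 ^+ 2) E H1 n => x y; nra.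
  rewrite -(ler_nat R) in p9.
  by rewrite natrD natrM [p.+1%:R]mulrSr; lra.
have epsV : eps^-1 <= (3 / 2) ^+ p.+1.
  rewrite -[eps^-1]mul1r -[1 / eps]lnK ?posrE ?divr_gt0 //.
  apply: le_trans (_ : expR (p.+1%:R * 3^-1) <= _); first by rewrite ler_expR.
  by rewrite expRM_natl lerXn2r ?nnegrE ?expR_ge0 ?expR_third_le.
rewrite ler_pdivrMr ?exprn_gt0 // -ler_pdivrMl // mulrC.
apply: le_trans (_ : 8 * g.+2%:R * (3 / 2) ^+ p.+1 <= _).
  by rewrite ler_wpM2l // mulr_ge0.
(* Cancelling (3 / 2) ^ p leaves 12 (g + 2) <= 2 ^ p. *)
have -> : 3 ^+ p = 2 ^+ p * (3 / 2) ^+ p :> R.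
  by rewrite -exprMn; congr (_ ^+ _); lra.
rewrite exprS mulrA; apply: ler_wpM2r; first by apply: exprn_ge0; lra.
have := pow2_ge_linear p9; rewrite -(ler_nat R) natrX natrM.
by rewrite -(ler_nat R) in gp; lra.
Qed.

Theorem theorem1 (R : realType) (eps gamma : R) (l : nat) :
  0 < eps -> eps < 1 -> 0 < gamma -> gamma < 1 -> (0 < l)%N ->
  Num.max (2 * expR 1 ^+ 2 / gamma * ln (1 / eps))
          (2 * expR 1 ^+ 2 / gamma * ln (4 * expR 1 ^+ 2)) <= l%:R ->
  exists N : nat, forall m : nat, (N <= m + l)%N ->
    exists A : graph (m + l) -> {set 'I_(m + l)} -> R,
      [/\ is_randomized_algorithm A,
          (forall (t : graph (m + l)) (H : {set 'I_(m + l)}),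
             is_tree t -> 0 < A t H -> (1 - gamma) * l%:R <= #|H|%:R)
        & (forall P : graph l, is_path P ->
             1 - eps <= prob_found_in_seed P A)].
Proof.
move=> e0 e1 y0 y1 l0 hl.
have [g [gl g4 gk geps]] := seed_constants e0 y0 y1 l0 hl.
(* The bound of [recoverable_prob] is uniform in [m], so any threshold serves. *)
exists 0%N => m _; exists (@find_seed_law R l m (l - g)); split.
- move=> t _; split=> [H|]; first exact: ler0n.
  rewrite (bigD1 (find_seed (l - g) t)) //= /find_seed_law eqxx big1 ?addr0 //.
  by move=> H /negPf->.
- move=> t H _; rewrite /find_seed_law; case: eqP => [-> _|]; last by rewrite ltxx.
  by apply: le_trans gk _; rewrite ler_nat find_seed_card // leq_subr.
- move=> P PP; apply: le_trans (recoverable_le_prob R m (l - g) P).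
  apply: le_trans (recoverable_prob R m PP gl g4).
  by rewrite lerD2l lerN2.
Qed.
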